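(* Let $r,t\in\mathbb{N}\cup\{0\}$ with $r+t>1$ and $2r+t>2$. For $x>0$ define $$\begin{aligned}\mathcal{F}(x):=\;&(-1)^r\sum_{j=0}^{t-2}\binom{j+r-1}{j}\frac{(-1)^{t-j}}{(t-j-1)!}\,\frac{1}{x^{j+r}}\sum_{m=1}^{\infty}\frac{\psi^{(t-j-1)}(mx+1)}{m^{2r+j}}\\&+\sum_{i=0}^{r-2}\frac{(-1)^i}{x^{t+i}}\binom{i+t-1}{i}\zeta(r+t+i)\,\zeta(r-i)-\frac{(-1)^r}{x^{r+t-1}}\binom{r+t-2}{t-1}\sum_{m=1}^{\infty}\frac{\gamma+\psi(mx+1)}{m^{2r+t-1}}.\end{aligned}$$ Then, for every $x>0$, $$\mathcal{F}(x)=x^{-t}\,\mathcal{F}\left(\frac1x\right).$$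
   Context: $\mathbb{N}=\{1,2,3,\dots\}$. $\zeta$ is the Riemann zeta function, $\gamma$ Euler's constant, $\psi=\Gamma'/\Gamma$ the digamma function and $\psi^{(j)}$ its $j$-th derivative. Conventions: $\binom{-1}{0}=1$, $\binom{c}{-1}=0$ for every $c\in\mathbb{Z}\setminus\{-1\}$, and $\binom{-1}{-1}=1$; $\binom{a}{b}=0$ for integers $0\le a<b$; empty sums are $0$. *)

(* Defs.v *)
From mathcomp Require Import all_boot all_order all_algebra.
From mathcomp Require Import all_classical all_reals all_analysis.

Set Implicit Arguments.
Unset Strict Implicit.
Unset Printing Implicit Defensive.

Import Order.TTheory GRing.Theory Num.Theory.
Import numFieldNormedType.Exports.

Local Open Scope classical_set_scope.
Local Open Scope ring_scope.

(* Euler's integral; meaningful for 0 < x. *)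
Definition Gamma {R : realType} (x : R) : R :=
  \int[@lebesgue_measure R]_(u in `]0, +oo[) (u `^ (x - 1) * expR (- u)).

Definition sum_from1 {R : realType} (u : nat -> R) : R :=
  limn (fun N : nat => \sum_(1 <= m < N.+1) u m).

Definition digamma {R : realType} (x : R) : R := derive1 Gamma x / Gamma x.

Definition euler_gamma (R : realType) : R :=
  limn (fun n : nat => \sum_(1 <= k < n.+1) k%:R^-1 - ln n%:R).

(* The Dirichlet series of the Riemann zeta function; meaningful for 1 < s. *)
Definition zeta {R : realType} (s : R) : R :=
  sum_from1 (fun n => n%:R `^ (- s)).

(* Binomial coefficients with the conventions binom(-1, 0) = 1,
   binom(c, -1) = 0 for c <> -1 and binom(-1, -1) = 1.  For 1 < r + t no other
   pair with a negative entry occurs in calF; such pairs are sent to 0. *)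
Definition binz (c k : int) : nat :=
  match c, k with
  | Posz a, Posz b => 'C(a, b)
  | Negz 0, Posz 0 => 1%N
  | Negz 0, Negz 0 => 1%N
  | _, _ => 0%N
  end.

Definition calF {R : realType} (r t : nat) (x : R) : R :=
  (-1) ^+ r *
    (\sum_(0 <= j < t.-1)
       (binz (j%:Z + r%:Z - 1) j%:Z)%:R
       * ((-1) ^+ (t - j) / ((t - j - 1)`!)%:R)
       * (1 / x ^+ (j + r))
       * sum_from1 (fun m =>
           derive1n (t - j - 1) digamma (m%:R * x + 1) / m%:R ^+ (2 * r + j)))
  + \sum_(0 <= i < r.-1)
      (-1) ^+ i / x ^+ (t + i)
      * (binz (i%:Z + t%:Z - 1) i%:Z)%:R
      * zeta (r + t + i)%:R * zeta (r - i)%:R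
  - (-1) ^+ r / x ^+ (r + t - 1)
    * (binz (r%:Z + t%:Z - 2) (t%:Z - 1))%:R
    * sum_from1 (fun m =>
        (euler_gamma R + digamma (m%:R * x + 1)) / m%:R ^+ (2 * r + t - 1)).

(* Main.v *)
Require Import Defs.
From mathcomp Require Import all_boot all_order all_algebra.
From mathcomp Require Import all_classical all_reals all_analysis.
From mathcomp Require Import measurable_realfun zify ring lra.

Set Implicit Arguments.
Unset Strict Implicit.
Unset Printing Implicit Defensive.

Import Order.TTheory GRing.Theory Num.Theory.
Import numFieldNormedType.Exports.

Local Open Scope classical_set_scope.
Local Open Scope ring_scope.

(** The function F is a double series in disguise: for [0 < x],

      F(x) = sum over m >= 1 and k >= 1 of 1 / (m^r k^r (k + m x)^t).

    In this form the functional equation is evident: replacing [x] by [1 / x]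
    turns [k + m / x] into [(m + k x) / x], so the terms are multiplied by
    [x^t] and the roles of [m] and [k] are exchanged; as they are nonnegative,
    the order of summation does not matter ([exchange_sums]).

    To obtain the double series, expand [1 / (k^r (k + y)^t)] with [y = m x]
    into partial fractions in [k] ([partial_fractions_regrouped]) and sum over
    [k]. The powers of [1 / k] of exponent at least 2 give zeta values. The
    powers of [1 / (k + y)] of exponent at least 2 give polygamma values at
    [y + 1]. The two simple poles have opposite coefficients and combine to a
    multiple of the sum of [1 / k - 1 / (k + y)], which is the Euler constant
    plus the digamma function at [y + 1]. Summing over [m] then gives exactly
    the terms of F, each of which converges separately ([double_series]).

    It remains to justify these series for the digamma function, starting from
    the Gamma integral ([digammaE], [polygammaE]). Only arguments above 1
    occur. Integration by parts gives [Gamma (z + 1) = z Gamma z], and a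
    tangent bound for [u^d] gives Wendel's inequality
    [Gamma (z + d) <= z^d Gamma z] for [0 <= d <= 1]. As in the theorem of Bohr
    and Mollerup, these two facts enclose the slopes of [ln Gamma] between two
    values of the expected derivative ([wendel_slope_bounds]). Such an
    enclosure by values of a continuous function forces differentiability
    ([slope_bounds_derive]). The polygamma series are differentiated by the
    same principle, since the terms [(k + y)^-n] are convex in [y]. *)

(** * Series indexed from 1 *)

Section Sums.
Context {R : realType}.
Implicit Types (u v : nat -> R) (l : R).

(** Convergence is part of this relation, whereas [sum_from1] has a value even
    on a divergent series. *)
Definition sums_to u l := (fun N => \sum_(1 <= m < N.+1) u m) @ \oo --> l.

Lemma sums_to_sum_from1 u l : sums_to u l -> sum_from1 u = l.
Proof. by move=> ul; apply: cvg_lim ul. Qed.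

Lemma eq_sums_to u v l :
  (forall m, (0 < m)%N -> u m = v m) -> sums_to u l -> sums_to v l.
Proof.
move=> uv; rewrite /sums_to.
under eq_fun do under eq_big_nat => m /andP[m0 _] do rewrite uv//.
by [].
Qed.

Lemma sums_toD u v l l' :
  sums_to u l -> sums_to v l' -> sums_to (fun m => u m + v m) (l + l').
Proof.
move=> ul vl; rewrite /sums_to.
under eq_fun do rewrite big_split /=.
exact: cvgD.
Qed.

Lemma sums_toZ c u l : sums_to u l -> sums_to (fun m => c * u m) (c * l).
Proof.
move=> ul; rewrite /sums_to.
under eq_fun do rewrite -mulr_sumr.
exact: cvgMr.
Qed.

Lemma sums_toN u l : sums_to u l -> sums_to (fun m => - u m) (- l).
Proof.
move=> /(@sums_toZ (-1)); rewrite mulN1r; apply: eq_sums_to => m _.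
by rewrite mulN1r.
Qed.

Lemma sums_toB u v l l' :
  sums_to u l -> sums_to v l' -> sums_to (fun m => u m - v m) (l - l').
Proof. by move=> ul /sums_toN; exact: sums_toD. Qed.

Lemma sums_to0 : sums_to (fun=> 0) 0.
Proof.
rewrite /sums_to; under eq_fun do rewrite big1_eq.
exact: cvg_cst.
Qed.

Lemma sums_to_sum n (u : nat -> nat -> R) (l : nat -> R) :
  (forall i, (i < n)%N -> sums_to (u i) (l i)) ->
  sums_to (fun m => \sum_(0 <= i < n) u i m) (\sum_(0 <= i < n) l i).
Proof.
elim: n => [_|n IH ul].
  rewrite big_geq//; apply: eq_sums_to sums_to0 => m _.
  by rewrite big_geq.
rewrite big_nat_recr//=.
have := sums_toD (IH (fun i h => ul i (ltnW h))) (ul n (ltnSn n)).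
by apply: eq_sums_to => m _; rewrite big_nat_recr.
Qed.

Lemma partial_sum_le u l N : (forall m, (0 < m)%N -> 0 <= u m) ->
  sums_to u l -> \sum_(1 <= m < N.+1) u m <= l.
Proof.
move=> u0 ul; rewrite -(sums_to_sum_from1 ul).
apply: (@nondecreasing_cvgn_le _ (fun N => \sum_(1 <= m < N.+1) u m)); last first.
  exact: cvgP ul.
apply/nondecreasing_seqP => n.
by rewrite [leRHS]big_nat_recr//= lerDl u0.
Qed.

Lemma sums_to_le_bound u l M : sums_to u l ->
  (forall N, \sum_(1 <= m < N.+1) u m <= M) -> l <= M.
Proof.
move=> ul uM; rewrite -(sums_to_sum_from1 ul).
apply: limr_le; first exact: cvgP ul.
by near=> N; exact: uM.
Unshelve. all: by end_near. Qed.

Lemma sums_to_ler u v l l' : sums_to u l -> sums_to v l' ->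
  (forall m, (0 < m)%N -> u m <= v m) -> l <= l'.
Proof.
move=> ul vl uv; apply: ler_cvg_to ul vl _.
by near=> N; apply: ler_sum_nat => m /andP[m0 _]; exact: uv.
Unshelve. all: by end_near. Qed.

Lemma bounded_sums_to u M : (forall m, (0 < m)%N -> 0 <= u m) ->
  (forall N, \sum_(1 <= m < N.+1) u m <= M) -> sums_to u (sum_from1 u).
Proof.
move=> u0 uM; apply: nondecreasing_is_cvgn.
  apply/nondecreasing_seqP => n.
  by rewrite [leRHS]big_nat_recr//= lerDl u0.
by exists M => _ [n _ <-]; exact: uM.
Qed.

Lemma dominated_sums_to u v l : sums_to v l ->
  (forall m, (0 < m)%N -> 0 <= u m <= v m) -> sums_to u (sum_from1 u).
Proof.
move=> vl uv; apply: (@bounded_sums_to _ l) => [m m0|N].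
  by have /andP[] := uv m m0.
apply: le_trans (partial_sum_le N _ vl); last first.
  by move=> m m0; have /andP[] := uv m m0; exact: le_trans.
by apply: ler_sum_nat => m /andP[m0 _]; have /andP[] := uv m m0.
Qed.

Let iterated_sums_le (a : nat -> nat -> R) (s s' : nat -> R) S S' :
  (forall m k, (0 < m)%N -> (0 < k)%N -> 0 <= a m k) ->
  (forall m, (0 < m)%N -> sums_to (a m) (s m)) -> sums_to s S ->
  (forall k, (0 < k)%N -> sums_to (a^~ k) (s' k)) -> sums_to s' S' ->
  S' <= S.
Proof.
move=> a0 as_ sS as' sS'.
have s0 m : (0 < m)%N -> 0 <= s m.
  move=> m0; have := partial_sum_le 0 (fun k => @a0 m k m0) (as_ m m0).
  by rewrite big_geq.
apply: sums_to_le_bound sS' _ => K.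
have colK : sums_to (fun m => \sum_(1 <= k < K.+1) a m k)
                    (\sum_(1 <= k < K.+1) s' k).
  have := @sums_to_sum K (fun i m => a m i.+1) (fun i => s' i.+1).
  rewrite big_add1/=.
  move=> /(_ (fun i _ => as' i.+1 isT)); apply: eq_sums_to => m _.
  by rewrite big_add1.
apply: sums_to_ler colK sS _ => m m0.
exact: partial_sum_le (fun k => @a0 m k m0) (as_ m m0).
Qed.

(** Tonelli for iterated sums of nonnegative terms. Every finite rectangle of
    terms is bounded by the sum over rows; letting first the number of rows
    and then the number of columns tend to infinity bounds the sum over
    columns by the sum over rows, and the situation is symmetric. *)
Lemma exchange_sums (a : nat -> nat -> R) (s s' : nat -> R) S S' :
  (forall m k, (0 < m)%N -> (0 < k)%N -> 0 <= a m k) ->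
  (forall m, (0 < m)%N -> sums_to (a m) (s m)) -> sums_to s S ->
  (forall k, (0 < k)%N -> sums_to (a^~ k) (s' k)) -> sums_to s' S' ->
  S = S'.
Proof.
move=> a0 as_ sS as' sS'; apply/eqP; rewrite eq_le.
rewrite (iterated_sums_le _ as_ sS as' sS')//.
rewrite (iterated_sums_le (a := fun m k => a k m) _ as' sS' as_ sS)//.
by move=> m k m0 k0; exact: a0.
Qed.

(** All convergence below goes back to this comparison: the inverse powers,
    the exponent 3/2 and Euler's constant are treated with differences of
    explicit decreasing sequences. *)
Lemma telescoping_sums_to u (f : nat -> R) : (forall m, 0 <= f m) ->
  (forall m, 0 <= u m.+1 <= f m - f m.+1) ->
  sums_to u (sum_from1 u) /\ sum_from1 u <= f 0%N.
Proof.
move=> f0 uf.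
have uM N : \sum_(1 <= m < N.+1) u m <= f 0%N.
  suff : \sum_(1 <= m < N.+1) u m <= f 0%N - f N.
    by move=> /le_trans; apply; rewrite gerBl.
  elim: N => [|N IH]; first by rewrite big_geq// subrr.
  rewrite big_nat_recr//=; have /andP[_ uN] := uf N.
  by apply: le_trans (lerD IH uN) _; rewrite addrA subrK.
have us : sums_to u (sum_from1 u).
  apply: bounded_sums_to uM => -[//|m] _.
  by have /andP[] := uf m.
by split=> //; exact: sums_to_le_bound us uM.
Qed.

Lemma sums_to_inv_pow n : (1 < n)%N ->
  sums_to (fun m => (m%:R ^+ n)^-1) (sum_from1 (fun m => (m%:R ^+ n)^-1)).
Proof.
move=> n1; apply: (proj1 (@telescoping_sums_to _ (fun m => 2 / m.+1%:R) _ _)).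
  by move=> m; rewrite divr_ge0.
move=> m; rewrite invr_ge0 exprn_ge0//=.
have m1 : 1 <= m.+1%:R :> R by rewrite ler1n.
have -> : 2 / m.+1%:R - 2 / m.+2%:R = 2 / (m.+1%:R * m.+2%:R) :> R.
  by rewrite -[m.+2%:R]natr1; field; lra.
apply: (@le_trans _ _ (m.+1%:R ^+ 2)^-1).
  by rewrite lef_pV2 ?posrE ?exprn_gt0// ler_weXn2l// ler1n.
rewrite ler_pdivlMr; last by rewrite mulr_gt0.
rewrite ler_pdivrMl ?exprn_gt0// -[m.+2%:R]natr1 expr2; nra.
Qed.

Lemma sums_to_inv_mul_sqrt :
  sums_to (fun m => (m%:R * Num.sqrt m%:R)^-1)
    (sum_from1 (fun m => (m%:R * Num.sqrt m%:R)^-1)).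
Proof.
(* With a, b the roots of m+1 and m+2, the difference 6/a - 6/b equals
   6/(ab(a+b)), and b <= 2a bounds ab(a+b) by 6a^3. *)
apply: (proj1 (@telescoping_sums_to _ (fun m => 6 / Num.sqrt m.+1%:R) _ _)).
  by move=> m; rewrite divr_ge0// sqrtr_ge0.
move=> m; rewrite invr_ge0 mulr_ge0 ?sqrtr_ge0//=.
have m1 : 1 <= m.+1%:R :> R by rewrite ler1n.
have a1 : 1 <= Num.sqrt (m.+1%:R : R).
  by rewrite -[leLHS]sqrtr1 ler_sqrt.
have ab : Num.sqrt (m.+1%:R : R) <= Num.sqrt m.+2%:R.
  by rewrite ler_sqrt// ler_nat.
have aE : Num.sqrt (m.+1%:R : R) ^+ 2 = m.+1%:R by rewrite sqr_sqrtr.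
have bE : Num.sqrt (m.+2%:R : R) ^+ 2 = m.+1%:R + 1 by rewrite sqr_sqrtr// natr1.
rewrite -{1}aE; move: aE bE.
set a := Num.sqrt _ in a1 ab *; set b := Num.sqrt _ in ab *.
move=> aE bE.
have b2a : b <= 2 * a by rewrite -ler_sqr ?nnegrE; nra.
have -> : 6 / a - 6 / b = 6 / (a * b * (a + b)).
  have : b ^+ 2 - a ^+ 2 = 1 by rewrite aE bE; ring.
  move=> ba1; have a0 : a != 0 by lra.
  have b0 : b != 0 by lra.
  have ab0 : a + b != 0 by lra.
  rewrite -[in RHS](mulr1 6) -ba1; field; lra.
rewrite ler_pdivlMr; last by nra.
rewrite ler_pdivrMl; last by nra.
nra.
Qed.

End Sums.

Arguments sums_toZ {R} c {u l} _.

(** * The Gamma integral to the right of 1 *)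

Section GammaFunction.
Context {R : realType}.
Notation mu := (@lebesgue_measure R).

Definition gamma_integrand (p u : R) := u `^ p * expR (- u).

(** The right limit of the primitive at 0 is separate because [u `^ p], like
    every power with positive exponent, is discontinuous at 0 from the left. *)
Lemma improper_FTC (f F : R -> R) (l : R) :
  (forall u, 0 <= u -> 0 <= f u) ->
  {within `[0, +oo[, continuous f} ->
  (forall u : R, 0 < u -> is_derive u 1 F (f u)) ->
  F u @[u --> 0^'+] --> F 0 -> F u @[u --> +oo] --> l ->
  mu.-integrable `]0, +oo[ (EFin \o f) /\
  \int[mu]_(u in `]0, +oo[) f u = l - F 0.
Proof.
move=> f0 cf dF F0 Fl.
have dF1 : {in `]0, +oo[, derive1 F =1 f}.
  move=> u; rewrite in_itv/= andbT => u0.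
  by have dFu := dF u u0; rewrite derive1E derive_val.
have dF2 u : 0 < u -> derivable F u 1.
  by move=> u0; have dFu := dF u u0; exact: ex_derive.
have If : mu.-integrable `[0, +oo[ (EFin \o f).
  apply/integrableP; split.
    apply/measurable_EFinP.
    exact: subspace_continuous_measurable_fun.
  rewrite (_ : integral _ _ _ = \int[mu]_(u in `[0%R, +oo[) (f u)%:E)%E.
    by rewrite (@ge0_continuous_FTC2y _ f F _ l)// -EFinB ltry.
  apply: eq_integral => u; rewrite inE/= in_itv/= andbT => u0.
  by rewrite ger0_norm// f0.
have If0 : mu.-integrable `]0, +oo[ (EFin \o f).
  apply: integrableS If => // u /=; rewrite !in_itv/= !andbT; exact: ltW.
split=> //; rewrite Rintegral_itv_obnd_cbnd//.
exact: Rintegral_ge0_continuous_FTC2y.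
Qed.

Lemma expR_half_cvg0 (c : R) : c * expR (- (u / 2)) @[u --> +oo] --> (0 : R).
Proof.
rewrite -[X in _ --> X](mulr0 c); apply: cvgMr.
apply: (@cvg_comp _ _ _ (fun u : R => u / 2) (fun u => expR (- u)) _
  (pinfty_nbhs R)); last exact: cvgr_expR.
exact: gt0_cvgMly.
Qed.

(** This is the inequality [t <= expR t] at [t = u / (2 * p)], raised to the
    power [p]. *)
Lemma powR_le_expR (p u : R) : 0 < p -> 0 <= u ->
  u `^ p <= (2 * p) `^ p * expR (u / 2).
Proof.
move=> p0 u0; have p2 : 0 < 2 * p by lra.
have -> : u / 2 = u / (2 * p) * p by field; lra.
rewrite expRM -powRM ?expR_ge0//; last lra.
apply: ge0_ler_powR; rewrite ?nnegrE ?mulr_ge0 ?expR_ge0//; try lra.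
rewrite -ler_pdivrMl// mulrC.
by apply: le_trans (expR_ge1Dx _); lra.
Qed.

(** All integrals and limits at infinity below are controlled by this bound,
    since [expR (- (u / 2))] has an elementary primitive. *)
Lemma gamma_integrand_le (p u : R) : 0 < p -> 0 <= u ->
  gamma_integrand p u <= (2 * p) `^ p * expR (- (u / 2)).
Proof.
move=> p0 u0; rewrite /gamma_integrand.
have -> : - u = - (u / 2) + - (u / 2) by field.
rewrite expRD mulrA ler_pM2r ?expR_gt0// expRN ler_pdivrMr ?expR_gt0//.
exact: powR_le_expR.
Qed.

Lemma gamma_integrand_ge0 p u : 0 <= gamma_integrand p u.
Proof. by rewrite mulr_ge0 ?powR_ge0 ?expR_ge0. Qed.

Lemma is_derive_expR_half (c u : R) :
  is_derive u 1 (fun u => - (2 * c) * expR (- (u / 2))) (c * expR (- (u / 2))).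
Proof. by apply: is_derive_eq; rewrite /GRing.scale/=; field. Qed.

Lemma continuous_expR_half (c : R) : continuous (fun u : R => c * expR (- (u / 2))).
Proof.
move=> u; apply: cvgMr.
apply: (@cvg_comp _ _ _ (fun u : R => - (u / 2)) expR); last exact: continuous_expR.
by apply: cvgN; apply: cvgMl; exact: cvg_id.
Qed.

Lemma integrable_expR_half (c : R) : 0 <= c ->
  mu.-integrable `]0, +oo[ (EFin \o (fun u => c * expR (- (u / 2)))) /\
  \int[mu]_(u in `]0, +oo[) (c * expR (- (u / 2))) = 2 * c.
Proof.
move=> c0; have -> : 2 * c = 0 - - (2 * c) * expR (- (0 / 2)).
  by rewrite mul0r oppr0 expR0; ring.
apply: (@improper_FTC _ (fun u => - (2 * c) * expR (- (u / 2)))).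
- by move=> u _; rewrite mulr_ge0// expR_ge0.
- by apply: continuous_subspaceT; exact: continuous_expR_half.
- by move=> u _; exact: is_derive_expR_half.
- by apply: cvg_at_right_filter; exact: continuous_expR_half.
- exact: expR_half_cvg0.
Qed.

Lemma gamma_integrand_cvg0 (p : R) : 0 < p ->
  gamma_integrand p u @[u --> 0^'+] --> gamma_integrand p 0.
Proof.
move=> p0; rewrite /gamma_integrand powR0 ?gt_eqF// mul0r.
rewrite -[X in _ --> X](mul0r (expR (- 0))).
apply: cvgM; first exact: powR_cvg0.
apply: cvg_at_right_filter.
apply: (@cvg_comp _ _ _ (fun u : R => - u) expR); last exact: continuous_expR.
by apply: cvgN; exact: cvg_id.
Qed.

Lemma is_derive_gamma_integrand (p u : R) : 0 < u ->
  is_derive u 1 (gamma_integrand p)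
    (p * gamma_integrand (p - 1) u - gamma_integrand p u).
Proof.
move=> u0; have dp := is_derive1_powR p u0.
rewrite /gamma_integrand; apply: is_derive_eq.
by rewrite /GRing.scale/=; ring.
Qed.

Lemma within_continuous_gamma_integrand (p : R) : 0 < p ->
  {within `[0, +oo[, continuous (gamma_integrand p)}.
Proof.
move=> p0; apply/continuous_within_itvcyP; split; last exact: gamma_integrand_cvg0.
move=> u; rewrite in_itv/= andbT => u0.
have [d _] := is_derive_gamma_integrand p u0.
exact/differentiable_continuous/derivable1_diffP.
Qed.

Lemma gamma_integrand_cvgy (p : R) : 0 < p ->
  gamma_integrand p u @[u --> +oo] --> (0 : R).
Proof.
move=> p0; apply: (squeeze_cvgr _ (cvg_cst 0) (expR_half_cvg0 ((2 * p) `^ p))).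
near=> u; rewrite gamma_integrand_ge0 gamma_integrand_le//.
Unshelve. all: by end_near. Qed.

Lemma integrable_gamma_integrand (p : R) : 0 < p ->
  mu.-integrable `]0, +oo[ (EFin \o gamma_integrand p).
Proof.
move=> p0; have c0 : 0 <= (2 * p) `^ p by exact: powR_ge0.
apply: le_integrable (proj1 (integrable_expR_half c0)) => //.
- apply/measurable_EFinP.
  apply: measurable_funS (subspace_continuous_measurable_fun _
    (within_continuous_gamma_integrand p0)) => //.
  by move=> u /=; rewrite !in_itv/= !andbT; exact: ltW.
- move=> u /=; rewrite in_itv/= andbT => u0.
  rewrite lee_fin !ger0_norm ?gamma_integrand_ge0 ?mulr_ge0 ?expR_ge0//.
  exact/gamma_integrand_le/ltW.
Qed.

Lemma GammaE (z : R) : Gamma z = \int[mu]_(u in `]0, +oo[) gamma_integrand (z - 1) u.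
Proof. by []. Qed.

(** Integration by parts: [z u^(z-1) e^(-u) - u^z e^(-u)] is the derivative of
    [u^z e^(-u)], which vanishes at both ends. This derivative changes sign;
    adding [c e^(-u/2)], the derivative of [- 2 c e^(-u/2)], makes it
    nonnegative, and the two contributions [2 c] cancel. *)
Lemma GammaD1 (z : R) : 1 < z -> Gamma (z + 1) = z * Gamma z.
Proof.
move=> z1; rewrite !GammaE addrK.
have p0 : 0 < z - 1 by lra.
have z0 : 0 < z by lra.
set c := (2 * z) `^ z; have c0 : 0 <= c by exact: powR_ge0.
pose G u := gamma_integrand z u + - (2 * c) * expR (- (u / 2)).
pose g u := z * gamma_integrand (z - 1) u - gamma_integrand z u + c * expR (- (u / 2)).
have [_ int_g] : mu.-integrable `]0, +oo[ (EFin \o g) /\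
    \int[mu]_(u in `]0, +oo[) g u = 0 - G 0.
  apply: improper_FTC.
  - move=> u u0; rewrite /g; have := gamma_integrand_le z0 u0.
    have := gamma_integrand_ge0 (z - 1) u; rewrite -/c; nra.
  - have cE : {within `[0, +oo[, continuous (fun u : R => c * expR (- (u / 2)))}.
      by apply: continuous_subspaceT; exact: continuous_expR_half.
    have cp := within_continuous_gamma_integrand p0.
    have cz := within_continuous_gamma_integrand z0.
    move=> u; apply: cvgD; last exact: cE.
    by apply: cvgB; [apply: cvgMr; exact: cp|exact: cz].
  - move=> u u0; apply: is_deriveD; first exact: is_derive_gamma_integrand.
    exact: is_derive_expR_half.
  - apply: cvgD; first exact: gamma_integrand_cvg0.
    by apply: cvg_at_right_filter; exact: continuous_expR_half.
  - rewrite -[X in _ --> X]addr0; apply: cvgD; first exact: gamma_integrand_cvgy.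
    exact: expR_half_cvg0.
have G0 : G 0 = - (2 * c).
  rewrite /G /gamma_integrand powR0 ?gt_eqF// !mul0r oppr0 expR0; ring.
have Ip := integrable_gamma_integrand p0.
have Iz := integrable_gamma_integrand z0.
have [Ie int_e] := integrable_expR_half c0.
have mI : measurable (`]0, +oo[ : set (measurableTypeR R)) by [].
have Izp : mu.-integrable `]0, +oo[
    (EFin \o (fun u => z * gamma_integrand (z - 1) u)).
  by have := integrableZl mI z Ip.
have Izz : mu.-integrable `]0, +oo[
    (EFin \o (fun u => z * gamma_integrand (z - 1) u - gamma_integrand z u)).
  by have := integrableB mI Izp Iz.
move: int_g; rewrite G0 /g RintegralD// RintegralB// RintegralZl// int_e; lra.
Qed.

(** On the interval [[1, 2]] the integrand is at least [expR (- 2)]. *)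
Lemma Gamma_gt0 (z : R) : 1 < z -> 0 < Gamma z.
Proof.
move=> z1; have p0 : 0 < z - 1 by lra.
have I := integrable_gamma_integrand p0.
have mI : measurable (`]0%R, +oo[ : set (measurableTypeR R)) by [].
rewrite GammaE /Rintegral; apply: fine_gt0; apply/andP; split; last first.
  by have := integrable_fin_num mI I; rewrite fin_numElt => /andP[].
have sI : `[1%R, 2%R] `<=` (`]0%R, +oo[ : set R).
  by move=> u /=; rewrite !in_itv/= => /andP[? _]; rewrite andbT; lra.
have mf := measurable_int _ I.
apply: (@lt_le_trans _ _
  (\int[mu]_(u in `[1%R, 2%R]) (gamma_integrand (z - 1) u)%:E)%E); last first.
  by apply: ge0_subset_integral => // u _; rewrite lee_fin gamma_integrand_ge0.
apply: (@lt_le_trans _ _ (\int[mu]_(u in `[1%R, 2%R]) (expR (- 2))%:E)%E).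
  rewrite integral_cst//= lebesgue_measure_itv/= lte_fin ifT; last by lra.
  by rewrite -EFinB -EFinM lte_fin mulr_gt0 ?expR_gt0//; lra.
apply: ge0_le_integral => //.
- exact: measurable_funS mf.
- move=> u; rewrite /= in_itv/= => /andP[u1 u2]; rewrite lee_fin /gamma_integrand.
  rewrite -[leLHS]mul1r; apply: ler_pM; rewrite ?expR_ge0//; last by rewrite ler_expR; lra.
  rewrite -[leLHS](powRr0 u); apply: ler_powR => //; lra.
Qed.

(** Weighted arithmetic-geometric mean inequality of [w] and 1, that is,
    convexity of the exponential between [ln w] and 0. *)
Lemma powR_le_tangent (d w : R) : 0 <= d <= 1 -> 0 < w -> w `^ d <= 1 - d + d * w.
Proof.
move=> /andP[d0 d1] w0.
have := convex_expR (Itv01 d0 d1) (ln w) 0.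
rewrite !convRE/= mulr0 addr0 lnK// expR0 mulr1 /unstable.onem/=.
rewrite /powR gt_eqF//; lra.
Qed.

(** Wendel's inequality, which stands in for the log-convexity of Gamma. Write
    [u^d = z^d (u/z)^d <= z^d (1 - d + d u/z)] under the integral: the right
    hand side integrates to [z^d ((1 - d) Gamma z + d Gamma (z + 1) / z)], and
    the functional equation turns the bracket into [Gamma z]. *)
Lemma GammaD_le (z d : R) : 1 < z -> 0 <= d <= 1 -> Gamma (z + d) <= z `^ d * Gamma z.
Proof.
move=> z1 /andP[d0 d1].
have p0 : 0 < z - 1 by lra.
have pz : 0 < z by lra.
have pd : 0 < z + d - 1 by lra.
have mI : measurable (`]0, +oo[ : set (measurableTypeR R)) by [].
have Ip := integrable_gamma_integrand p0.
have Iz := integrable_gamma_integrand pz.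
have Id := integrable_gamma_integrand pd.
have I1 : mu.-integrable `]0, +oo[
    (EFin \o (fun u => (1 - d) * gamma_integrand (z - 1) u)).
  by have := integrableZl mI (1 - d) Ip.
have I2 : mu.-integrable `]0, +oo[
    (EFin \o (fun u => d / z * gamma_integrand z u)).
  by have := integrableZl mI (d / z) Iz.
have I3 : mu.-integrable `]0, +oo[
    (EFin \o (fun u => (1 - d) * gamma_integrand (z - 1) u
      + d / z * gamma_integrand z u)).
  by have := integrableD mI I1 I2.
have I4 : mu.-integrable `]0, +oo[
    (EFin \o (fun u => z `^ d * ((1 - d) * gamma_integrand (z - 1) u
      + d / z * gamma_integrand z u))).
  by have := integrableZl mI (z `^ d) I3.
have -> : z `^ d * Gamma z = \int[mu]_(u in `]0, +oo[)
   (z `^ d * ((1 - d) * gamma_integrand (z - 1) u + d / z * gamma_integrand z u)).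
  rewrite RintegralZl// RintegralD// !RintegralZl// -[X in _ * X + _ * _]GammaE.
  rewrite -[X in gamma_integrand X](addrK 1) -GammaE GammaD1//; field; lra.
apply: le_Rintegral => // u /=; rewrite in_itv/= andbT => u0.
rewrite /gamma_integrand.
have -> : z + d - 1 = z - 1 + d by ring.
rewrite powRD; last by rewrite (gt_eqF u0) implybT.
have -> : u `^ z = u `^ (z - 1) * u.
  by rewrite mulrC mulr_powRB1// ltW.
have -> : u `^ d = z `^ d * (u / z) `^ d.
  rewrite -powRM; [|lra|by rewrite divr_ge0; lra].
  by congr (_ `^ _); field; lra.
have : (u / z) `^ d <= 1 - d + d * (u / z).
  by apply: powR_le_tangent; [exact/andP|exact: divr_gt0].
have : 0 <= u `^ (z - 1) * expR (- u) * z `^ d by rewrite !mulr_ge0 ?powR_ge0 ?expR_ge0.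
move: (_ `^ _) (_ `^ _) (expR _) => a b c abc0 tangent.
by have := ler_wpM2l abc0 tangent; congr (_ <= _); ring.
Qed.

End GammaFunction.

(** * Derivatives from two-sided slope bounds *)

Section SlopeBounds.
Context {R : realType}.
Implicit Types (h g : R -> R) (x y a b : R).

(** On the half-line above 1, [h] is convex and [g] selects one of its
    subgradients. Increments are restricted to length 1 because Wendel's
    inequality covers exactly those, and only small ones matter for
    derivatives. *)
Definition slope_bounds h g := forall a b, 1 < a -> a < b -> b <= a + 1 ->
  g a * (b - a) <= h b - h a <= g b * (b - a).

Lemma slope_bounds_homo h g a b : slope_bounds h g ->
  1 < a -> a < b -> b <= a + 1 -> g a <= g b.
Proof.
move=> hg a1 ab ba; have /andP[h1 h2] := hg a b a1 ab ba.
have := le_trans h1 h2; rewrite ler_pM2r//; lra.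
Qed.

(** The slopes of [h] near [x] are bounded since [g] is monotone, so [h] is
    Lipschitz there. *)
Lemma slope_bounds_continuous h g x : slope_bounds h g -> 1 < x ->
  {for x, continuous h}.
Proof.
move=> hg x1.
(* The interval [x - e, x + e] stays above 1 and has length at most 1. *)
pose e := Num.min (2^-1) ((x - 1) / 2).
have e0 : 0 < e by rewrite lt_min; apply/andP; split; lra.
have e1 : e <= 2^-1 by rewrite ge_min lexx.
have e2 : e <= (x - 1) / 2 by rewrite ge_min lexx orbT.
pose K := `|g (x - e)| + `|g (x + e)|.
have K1 : - K <= g (x - e).
  have := normr_ge0 (g (x + e)); have := ler_norm (- g (x - e)).
  by rewrite normrN /K; lra.
have K2 : g (x + e) <= K.
  by have := normr_ge0 (g (x - e)); have := ler_norm (g (x + e)); rewrite /K; lra.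
apply: (@squeeze_cvgr _ _ _ _ (fun y => h x - K * `|y - x|) (fun y => h x + K * `|y - x|)).
- near=> y.
  have : `|y - x| < e.
    by near: y; apply/nbhs_ballP; exists e => //= y; rewrite /ball/= distrC.
  rewrite ltr_norml => /andP[y1 y2].
  have [yx|xy|<-] := ltgtP y x; last first.
  + by rewrite subrr normr0 mulr0; lra.
  + rewrite gtr0_norm ?subr_gt0//.
    have xy1 : y <= x + 1 by lra.
    have /andP[h1 h2] := hg x y x1 xy xy1.
    have g1 : g (x - e) <= g x by apply: slope_bounds_homo hg _ _ _; lra.
    have g2 : g y <= g (x + e) by apply: slope_bounds_homo hg _ _ _; lra.
    nra.
  + rewrite ltr0_norm ?subr_lt0//.
    have yx1 : x <= y + 1 by lra.
    have y3 : 1 < y by lra.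
    have /andP[h1 h2] := hg y x y3 yx yx1.
    have g1 : g (x - e) <= g y by apply: slope_bounds_homo hg _ _ _; lra.
    have g2 : g x <= g (x + e) by apply: slope_bounds_homo hg _ _ _; lra.
    nra.
- rewrite -[X in _ --> X](_ : h x - K * `|x - x| = _); last first.
    by rewrite subrr normr0 mulr0 subr0.
  apply: cvgB; first exact: cvg_cst.
  by apply: cvgMr; apply: cvg_norm; apply: cvgB; [exact: cvg_id|exact: cvg_cst].
- rewrite -[X in _ --> X](_ : h x + K * `|x - x| = _); last first.
    by rewrite subrr normr0 mulr0 addr0.
  apply: cvgD; first exact: cvg_cst.
  by apply: cvgMr; apply: cvg_norm; apply: cvgB; [exact: cvg_id|exact: cvg_cst].
Unshelve. all: by end_near. Qed.

(** The difference quotient of [h] between [x] and [x + d] lies between [g x]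
    and [g (x + d)]. Derivatives of series are obtained in this way from
    termwise inequalities, with no appeal to uniform convergence. *)
Lemma slope_bounds_derive h g x : slope_bounds h g -> 1 < x ->
  {for x, continuous g} -> is_derive x 1 h (g x).
Proof.
move=> hg x1 gx.
have slope_cvg : (fun d => d^-1 *: (h (d *: 1 + x) - h x)) @ 0^' --> g x.
  apply/cvgrPdist_le => e e0.
  have gd : \forall d \near (0 : R)^', `|g x - g (d + x)| <= e.
    apply: nbhs_dnbhs.
    have : (fun d => g (d + x)) @ (0 : R) --> g x.
      have dx : (fun d : R => d + x) @ (0 : R) --> x.
        rewrite -[X in _ --> X]add0r.
        by apply: cvgD; [exact: cvg_id|exact: cvg_cst].
      exact: cvg_comp dx gx.
    by move=> /cvgrPdist_le; apply.
  near=> d.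
  have d0 : d != 0 by near: d; exact: nbhs_dnbhs_neq.
  have ge : `|g x - g (d + x)| <= e by near: d.
  have : `|d| < Num.min 1 (x - 1).
    by near: d; apply: dnbhs0_lt; rewrite lt_min ltr01 subr_gt0.
  rewrite lt_min => /andP[]; rewrite !ltr_norml => /andP[d1 d2] /andP[d3 d4].
  rewrite [d *: 1]mulr1; apply: le_trans ge.
  rewrite [_ *: _]mulrC.
  have [dn|dp|/eqP] := ltgtP d 0; last by rewrite (negbTE d0).
  - have h1 : 1 < d + x by lra.
    have h2 : d + x < x by lra.
    have h3 : x <= d + x + 1 by lra.
    have /andP[l1 l2] := hg _ _ h1 h2 h3.
    have dE : x - (d + x) = - d by ring.
    rewrite dE -ler_pdivlMr ?oppr_gt0// in l1.
    rewrite dE -ler_pdivrMr ?oppr_gt0// in l2.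
    have sE : (h (d + x) - h x) / d = (h x - h (d + x)) / - d by field.
    rewrite sE; move: (_ / - d) l1 l2 => s l1 l2.
    rewrite !ger0_norm ?subr_ge0//; lra.
  - have h2 : x < d + x by lra.
    have h3 : d + x <= x + 1 by lra.
    have /andP[l1 l2] := hg _ _ x1 h2 h3.
    rewrite addrK -ler_pdivlMr// in l1.
    rewrite addrK -ler_pdivrMr// in l2.
    move: (_ / d) l1 l2 => s l1 l2.
    rewrite distrC [leRHS]distrC !ger0_norm ?subr_ge0//; lra.
apply: DeriveDef; first exact: cvgP slope_cvg.
exact: cvg_lim slope_cvg.
Unshelve. all: by end_near. Qed.

End SlopeBounds.

(** * Hurwitz sums, harmonic sums and Euler's constant *)

Section Polygamma.
Context {R : realType}.
Implicit Types (x y a b z : R).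

(** This is the Hurwitz zeta value at [n] with parameter [y + 1]. *)
Definition hurwitz_sum n y : R := sum_from1 (fun k => ((k%:R + y) ^+ n)^-1).

(** The harmonic number of real order [y]; it is the sum of the Euler constant
    and the digamma function at [y + 1]. *)
Definition harmonic_sum y : R := sum_from1 (fun k => k%:R^-1 - (k%:R + y)^-1).

Lemma natr_ge1 k : (0 < k)%N -> 1 <= k%:R :> R.
Proof. by move=> k0; rewrite ler1n. Qed.

Lemma hurwitz_sumP n y : (1 < n)%N -> 0 < y ->
  sums_to (fun k => ((k%:R + y) ^+ n)^-1) (hurwitz_sum n y).
Proof.
move=> n1 y0; apply: dominated_sums_to (@sums_to_inv_pow R n n1) _ => k k0.
have k1 := natr_ge1 k0.
have ky : 0 < k%:R + y by lra.
rewrite invr_ge0 exprn_ge0 ?(ltW ky)//= lef_pV2 ?posrE ?exprn_gt0//; last lra.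
by rewrite lerXn2r ?nnegrE//; lra.
Qed.

(** Compare [(k + y)^-(n+2)] with the telescoping product
    [y^-n / ((k + y - 1) (k + y))]. *)
Lemma hurwitz_sum_le n y : 0 < y -> hurwitz_sum n.+2 y <= (y ^+ n.+1)^-1.
Proof.
move=> y0; rewrite exprSr invfM.
have [] // := @telescoping_sums_to R (fun k => ((k%:R + y) ^+ n.+2)^-1)
  (fun k => (y ^+ n)^-1 * (k%:R + y)^-1).
- by move=> k; rewrite mulr_ge0// invr_ge0 ?exprn_ge0 ?addr_ge0// ltW.
- move=> k; have k0 : 0 <= k%:R :> R by [].
  have yn : 0 < y ^+ n by rewrite exprn_gt0.
  rewrite -natr1 invr_ge0 exprn_ge0/=; last lra.
  rewrite -mulrBr.
  have -> : (k%:R + y)^-1 - (k%:R + 1 + y)^-1 = ((k%:R + y) * (k%:R + 1 + y))^-1.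
    by field; lra.
  rewrite 2!exprSr -mulrA invfM ler_pM ?invr_ge0 ?exprn_ge0 ?mulr_ge0//; try lra.
    by rewrite lef_pV2 ?posrE ?exprn_gt0//; [rewrite lerXn2r ?nnegrE//|]; lra.
  by rewrite lef_pV2 ?posrE; nra.
- by rewrite add0r.
Qed.

Lemma inv_sub_inv_ge0 k y : (0 < k)%N -> 0 < y -> 0 <= k%:R^-1 - (k%:R + y)^-1.
Proof.
move=> k0 y0; have k1 := natr_ge1 k0.
rewrite subr_ge0 lef_pV2 ?posrE; lra.
Qed.

Lemma harmonic_sumP y : 0 < y ->
  sums_to (fun k => k%:R^-1 - (k%:R + y)^-1) (harmonic_sum y).
Proof.
move=> y0.
have H := sums_toZ y (@sums_to_inv_pow R 2 isT).
apply: dominated_sums_to H _ => k k0.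
have k1 := natr_ge1 k0.
rewrite inv_sub_inv_ge0//=.
have -> : k%:R^-1 - (k%:R + y)^-1 = y * (k%:R * (k%:R + y))^-1 by field; lra.
rewrite ler_pM2l// lef_pV2 ?posrE; nra.
Qed.

(** The growth is logarithmic, but a square root bound is enough for the outer
    sum over [m] and follows termwise from [2 sqrt (k y) <= k + y]. *)
Lemma harmonic_sum_le y : 0 < y ->
  harmonic_sum y <= sum_from1 (fun k => (k%:R * Num.sqrt k%:R)^-1) * Num.sqrt y.
Proof.
move=> y0; rewrite mulrC.
apply: sums_to_ler (harmonic_sumP y0) (sums_toZ _ (@sums_to_inv_mul_sqrt R)) _.
move=> k k0; have k1 := natr_ge1 k0.
have -> : k%:R^-1 - (k%:R + y)^-1 = y / (k%:R * (k%:R + y)) by field; lra.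
have : 1 <= Num.sqrt (k%:R : R) by rewrite -[leLHS]sqrtr1 ler_sqrt.
have : 0 < Num.sqrt y by rewrite sqrtr_gt0.
have : Num.sqrt y ^+ 2 = y by rewrite sqr_sqrtr// ltW.
have : Num.sqrt k%:R ^+ 2 = k%:R :> R by rewrite sqr_sqrtr.
move: (Num.sqrt y) (Num.sqrt k%:R) => s c cE sE s0 c1.
rewrite ler_pdivrMr; last nra.
have -> : s / (k%:R * c) * (k%:R * (k%:R + y)) = s * ((k%:R + y) / c) by field; lra.
rewrite -sE expr2 ler_pM2l// ler_pdivlMr; last lra.
rewrite -cE; nra.
Qed.

(** The mean value inequality for the convex function [a^-n]. *)
Lemma inv_pow_slope n a b : 0 < a -> a < b ->
  n%:R / b ^+ n.+1 * (b - a) <= (a ^+ n)^-1 - (b ^+ n)^-1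
    <= n%:R / a ^+ n.+1 * (b - a).
Proof.
move=> a0 ab; have b0 : 0 < b by lra.
rewrite -!exprVn.
have U0 : 0 < a^-1 by rewrite invr_gt0.
have V0 : 0 < b^-1 by rewrite invr_gt0.
have UV : b^-1 <= a^-1 by rewrite lef_pV2 ?posrE//; lra.
have E : a^-1 - b^-1 = a^-1 * b^-1 * (b - a) by field; lra.
move: (a^-1) (b^-1) U0 V0 UV E => U V U0 V0 UV E.
have d0 : 0 <= b - a by lra.
elim: n => [|n IH]; first by rewrite !mul0r !expr0 subrr lexx.
have -> : U ^+ n.+1 - V ^+ n.+1 = U * (U ^+ n - V ^+ n) + V ^+ n * (U * V) * (b - a).
  by rewrite -[RHS]addr0 -mulrA -E !exprS; ring.
have /andP[l1 l2] := IH.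
have Vn : 0 <= V ^+ n by rewrite exprn_ge0// ltW.
have UVn : V ^+ n <= U ^+ n by rewrite lerXn2r ?nnegrE// ltW.
move: l1 l2 d0; rewrite -(natr1 n) !exprS; move: (b - a) => D.
move: (U ^+ n) (V ^+ n) Vn UVn => Un Vn' Vn UVn l1 l2 d0.
have n0 : 0 <= n%:R :> R by [].
apply/andP; split.
  have h1 := ler_wpM2l (ltW U0) l1.
  have h2 : 0 <= (U - V) * (n%:R * (V * Vn') * D + V * Vn' * D).
    by rewrite mulr_ge0 ?subr_ge0// addr_ge0 ?mulr_ge0// ltW.
  have -> : (n%:R + 1) * (V * (V * Vn')) * D = U * (n%:R * (V * Vn') * D)
    + Vn' * (U * V) * D - (U - V) * (n%:R * (V * Vn') * D + V * Vn' * D) by ring.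
  by lra.
have h1 := ler_wpM2l (ltW U0) l2.
have h2 : 0 <= (U * Un - V * Vn') * (U * D).
  by rewrite !mulr_ge0 ?subr_ge0 ?ler_pM// ltW.
have -> : (n%:R + 1) * (U * (U * Un)) * D = U * (n%:R * (U * Un) * D)
    + Vn' * (U * V) * D + (U * Un - V * Vn') * (U * D) by ring.
by lra.
Qed.

Lemma hurwitz_slope_bounds n : (1 < n)%N ->
  slope_bounds (fun z => hurwitz_sum n (z - 1))
               (fun z => - n%:R * hurwitz_sum n.+1 (z - 1)).
Proof.
move=> n1 a b a1 ab _.
have a0 : 0 < a - 1 by lra.
have b0 : 0 < b - 1 by lra.
have n2 : (1 < n.+1)%N by apply: ltnW.
have D := sums_toB (hurwitz_sumP n1 b0) (hurwitz_sumP n1 a0).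
have Ea := sums_toZ (- n%:R * (b - a)) (hurwitz_sumP n2 a0).
have Eb := sums_toZ (- n%:R * (b - a)) (hurwitz_sumP n2 b0).
have key k : (0 < k)%N ->
  - n%:R * (b - a) * ((k%:R + (a - 1)) ^+ n.+1)^-1 <=
   ((k%:R + (b - 1)) ^+ n)^-1 - ((k%:R + (a - 1)) ^+ n)^-1 <=
  - n%:R * (b - a) * ((k%:R + (b - 1)) ^+ n.+1)^-1.
  move=> k0; have k1 := natr_ge1 k0.
  have ka : 0 < k%:R + (a - 1) by lra.
  have kb : k%:R + (a - 1) < k%:R + (b - 1) by lra.
  have := inv_pow_slope n ka kb.
  have -> : k%:R + (b - 1) - (k%:R + (a - 1)) = b - a by ring.
  move: (_^-1) (_^-1) (_^-1) (_^-1) => p q r s; lra.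
rewrite ![_ * _ * (b - a)]mulrAC; apply/andP; split.
  by apply: sums_to_ler Ea D _ => k /key/andP[].
by apply: sums_to_ler D Eb _ => k /key/andP[].
Qed.

Lemma harmonic_sum_sub a b : 0 < a -> 0 < b ->
  sums_to (fun k => (k%:R + a)^-1 - (k%:R + b)^-1) (harmonic_sum b - harmonic_sum a).
Proof.
move=> a0 b0; have := sums_toB (harmonic_sumP b0) (harmonic_sumP a0).
by apply: eq_sums_to => k _; ring.
Qed.

Lemma harmonic_slope_bounds :
  slope_bounds (fun z => - harmonic_sum (z - 1)) (fun z => - hurwitz_sum 2 (z - 1)).
Proof.
move=> a b a1 ab _.
have a0 : 0 < a - 1 by lra.
have b0 : 0 < b - 1 by lra.
have D := harmonic_sum_sub a0 b0.
have Ea := sums_toZ (b - a) (hurwitz_sumP (isT : 1 < 2)%N a0).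
have Eb := sums_toZ (b - a) (hurwitz_sumP (isT : 1 < 2)%N b0).
have key k : (0 < k)%N ->
  (b - a) * ((k%:R + (b - 1)) ^+ 2)^-1 <=
   (k%:R + (a - 1))^-1 - (k%:R + (b - 1))^-1 <=
  (b - a) * ((k%:R + (a - 1)) ^+ 2)^-1.
  move=> k0; have k1 := natr_ge1 k0.
  have ka : 0 < k%:R + (a - 1) by lra.
  have kb : k%:R + (a - 1) < k%:R + (b - 1) by lra.
  have := inv_pow_slope 1 ka kb; rewrite !expr1.
  have -> : k%:R + (b - 1) - (k%:R + (a - 1)) = b - a by ring.
  by rewrite !mul1r ![_ * (b - a)]mulrC.
have h1 : (b - a) * hurwitz_sum 2 (b - 1) <= harmonic_sum (b - 1) - harmonic_sum (a - 1).
  by apply: sums_to_ler Eb D _ => k /key/andP[].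
have h2 : harmonic_sum (b - 1) - harmonic_sum (a - 1) <= (b - a) * hurwitz_sum 2 (a - 1).
  by apply: sums_to_ler D Ea _ => k /key/andP[].
rewrite !mulNr ![_ * (b - a)]mulrC; lra.
Qed.

Lemma ln_sub_ge a b : 0 < a -> 0 < b -> (b - a) / b <= ln b - ln a.
Proof.
move=> a0 b0.
have := @le_ln1Dx R (a / b - 1).
have -> : 1 + (a / b - 1) = a / b by ring.
rewrite ln_div ?posrE//.
have -> : (b - a) / b = 1 - a / b by field; lra.
have : 0 < a / b by rewrite divr_gt0.
move: (a / b) => q q0 /(_ _); lra.
Qed.

Lemma ln_sub_le a b : 0 < a -> 0 < b -> ln b - ln a <= (b - a) / a.
Proof.
by move=> a0 b0; have := ln_sub_ge b0 a0; rewrite -(opprB b a) mulNr; lra.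
Qed.

Lemma ln_add_nat_cvg0 a : 0 < a -> (fun n : nat => ln (a + n%:R) - ln n%:R) @ \oo --> 0.
Proof.
move=> a0.
apply: (@squeeze_cvgr _ _ _ _ (fun=> 0) (fun n : nat => a * n%:R^-1)).
- near=> n.
  have n0 : 0 < n%:R :> R by rewrite ltr0n; near: n; exists 1%N.
  have an0 : 0 < a + n%:R by lra.
  have := ln_sub_le n0 an0; have := ln_sub_ge n0 an0.
  rewrite addrK => h1 ->; rewrite andbT; apply: le_trans h1.
  by rewrite divr_ge0 ?ltW.
- exact: cvg_cst.
- rewrite -[X in _ --> X](mulr0 a); apply: cvgMr.
  by apply/gtr0_cvgV0; [exists 1%N => // n /=; rewrite ltr0n|exact: cvgr_idn].
Unshelve. all: by end_near. Qed.

(** The sequence at [n + 1] is 1 minus a partial sum of the nonnegative terms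
    [ln (k + 1) - ln k - 1 / (k + 1)], which are dominated by
    [1 / k - 1 / (k + 1)]. *)
Lemma euler_gammaP :
  (fun n : nat => \sum_(1 <= k < n.+1) k%:R^-1 - ln n%:R : R) @ \oo --> euler_gamma R.
Proof.
suff H : cvgn (fun n : nat => \sum_(1 <= k < n.+1) k%:R^-1 - ln n%:R : R) by exact: H.
pose u k : R := ln k.+1%:R - ln k%:R - k.+1%:R^-1.
have [u_cvg _] : sums_to u (sum_from1 u) /\ sum_from1 u <= (0.+1%:R)^-1.
  apply: (@telescoping_sums_to _ u (fun k => k.+1%:R^-1)).
    by move=> k; rewrite invr_ge0.
  move=> m; rewrite /u.
  have m1 : 0 < m.+1%:R :> R by rewrite ltr0n.
  have m2 : 0 < m.+2%:R :> R by rewrite ltr0n.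
  have := ln_sub_le m1 m2; have := ln_sub_ge m1 m2.
  have -> : m.+2%:R - m.+1%:R = 1 :> R by rewrite -natr1; ring.
  rewrite !mul1r.
  move: (ln m.+2%:R) (ln m.+1%:R) (m.+2%:R^-1) (m.+1%:R^-1) => p q s t; lra.
suff : (fun n : nat => \sum_(1 <= k < n.+2) k%:R^-1 - ln n.+1%:R : R) @ \oo -->
    1 - sum_from1 u.
  rewrite (cvg_shiftS (fun n : nat => \sum_(1 <= k < n.+1) k%:R^-1 - ln n%:R : R)).
  exact: cvgP.
have -> : (fun n => \sum_(1 <= k < n.+2) k%:R^-1 - ln n.+1%:R) =
   (fun n => 1 - \sum_(1 <= k < n.+1) u k).
  apply/funext; elim => [|n IH].
    by rewrite big_nat1 invr1 big_geq// ln1.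
  rewrite big_nat_recr//= [in RHS]big_nat_recr//=.
  have -> : \sum_(1 <= k < n.+2) k%:R^-1 = 1 - \sum_(1 <= k < n.+1) u k + ln n.+1%:R :> R.
    by rewrite -IH; ring.
  by rewrite /u; ring.
by apply: cvgB u_cvg; exact: cvg_cst.
Qed.

End Polygamma.

(** * Digamma and polygamma values as series *)

Section Digamma.
Context {R : realType}.
Implicit Types (x y a b z d : R).

(** The uniqueness argument of Bohr and Mollerup: the functional equation and
    Wendel's inequality pin down the slopes of [h = ln Gamma]. Nothing
    else about Gamma enters. *)
Section WendelInequality.
Variable h : R -> R.
Hypothesis hD1 : forall z, 1 < z -> h (z + 1) = ln z + h z.
Hypothesis hD_le : forall z d, 1 < z -> 0 <= d <= 1 -> h (z + d) <= d * ln z + h z.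

Let hDn z n : 1 < z ->
  h (z + n%:R) = h z + \sum_(1 <= k < n.+1) ln (k%:R + (z - 1)).
Proof.
move=> z1; elim: n => [|n IH]; first by rewrite big_geq// !addr0.
have n0 : 0 <= n%:R :> R by [].
rewrite big_nat_recr//= -natr1 addrA hD1; last lra.
rewrite IH; have -> : n%:R + 1 + (z - 1) = z + n%:R by ring.
ring.
Qed.

(** The inequality from above, applied with increment [1 - d] at [z + d], is a
    bound from below at [z]. *)
Let hD_ge z d : 1 < z -> 0 <= d <= 1 -> d * ln z - d / z + h z <= h (z + d).
Proof.
move=> z1 /andP[d0 d1].
have zd1 : 1 < z + d by lra.
have d01 : 0 <= 1 - d <= 1 by apply/andP; split; lra.
have := hD_le zd1 d01.
have -> : z + d + (1 - d) = z + 1 by ring.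
rewrite hD1//.
have z0 : 0 < z by lra.
have zd0 : 0 < z + d by lra.
have := ln_sub_le z0 zd0; rewrite addrAC subrr add0r.
have : 0 <= d / z by rewrite divr_ge0// ltW.
move: (h (z + d)) (h z) (ln (z + d)) (ln z) (d / z) => p q r s t.
nra.
Qed.

(** Shift [a] and [b] by [n]: by the functional equation [h b - h a] equals
    [h (b + n) - h (a + n)], which Wendel's inequality makes asymptotic to
    [(b - a) ln n], minus increments of the logarithm. The latter lie
    between [(b - a) / (k + b - 1)] and [(b - a) / (k + a - 1)], and
    [ln n] minus the sum of [1 / (k + y)] tends to [harmonic_sum y] minus the
    Euler constant. *)
Lemma wendel_slope_bounds :
  slope_bounds h (fun z => harmonic_sum (z - 1) - euler_gamma R).
Proof.
move=> a b a1 ab ba.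
have a0 : 0 < a by lra.
have b1 : 1 < b by lra.
pose H n : R := \sum_(1 <= k < n.+1) k%:R^-1.
pose S y n : R := \sum_(1 <= k < n.+1) (k%:R^-1 - (k%:R + (y - 1))^-1).
(* The same shift a + n serves both bounds; only y varies, in {a, b}. *)
pose B y n := ln (a + n%:R) - ln n%:R - (H n - ln n%:R) + S y n.
have cvgB_ y : 1 < y -> B y n @[n --> \oo] --> harmonic_sum (y - 1) - euler_gamma R.
  move=> y1; rewrite addrC -[- _]add0r; apply: cvgD.
    by apply: cvgB; [exact: ln_add_nat_cvg0|exact: euler_gammaP].
  by apply: harmonic_sumP; lra.
have BE y n : B y n = ln (a + n%:R) - \sum_(1 <= k < n.+1) (k%:R + (y - 1))^-1.
  by rewrite /B /S sumrB /H; ring.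
have d01 : 0 <= b - a <= 1 by apply/andP; split; lra.
have an1 n : 1 < a + n%:R by have : 0 <= n%:R :> R by []; lra.
have GE n : h b - h a =
    h (a + n%:R + (b - a)) - h (a + n%:R)
    - \sum_(1 <= k < n.+1) (ln (k%:R + (b - 1)) - ln (k%:R + (a - 1))).
  have -> : a + n%:R + (b - a) = b + n%:R by ring.
  by rewrite !hDn// sumrB; ring.
have lnS n : \sum_(1 <= k < n.+1) (k%:R + (b - 1))^-1 * (b - a) <=
    \sum_(1 <= k < n.+1) (ln (k%:R + (b - 1)) - ln (k%:R + (a - 1))) <=
    \sum_(1 <= k < n.+1) (k%:R + (a - 1))^-1 * (b - a).
  apply/andP; split; apply: ler_sum_nat => k /andP[k0 _];
    have k1 := @natr_ge1 R k k0;
    have ka : 0 < k%:R + (a - 1) by lra.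
  - have kb : 0 < k%:R + (b - 1) by lra.
    by have := ln_sub_ge ka kb; congr (_ <= _); field; lra.
  - have kb : 0 < k%:R + (b - 1) by lra.
    by have := ln_sub_le ka kb; congr (_ <= _); field; lra.
apply/andP; split.
- have inv_cvg : (fun n : nat => (a + n%:R)^-1) @ \oo --> (0 : R).
    apply/gtr0_cvgV0; first by exists 0%N => // n _ /=; have := an1 n; lra.
    apply/cvgryPge => A; near=> n.
    have : A <= n%:R by near: n; exact: nbhs_infty_ger.
    lra.
  have L : (B a n - (a + n%:R)^-1) * (b - a) @[n --> \oo] -->
      (harmonic_sum (a - 1) - euler_gamma R - 0) * (b - a).
    by apply: cvgMl; apply: cvgB => //; exact: cvgB_.
  rewrite subr0 in L; apply: ler_cvg_to L (cvg_cst _) _; near=> n.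
  have /andP[_ l2] := lnS n.
  rewrite (GE n) BE; have := hD_ge (an1 n) d01.
  move: l2; rewrite -mulr_suml.
  move: (\sum_(1 <= k < n.+1) _) (\sum_(1 <= k < n.+1) _) => s1 s2.
  move: (h _) (h _) (ln _) (_^-1) => p q r w; nra.
- have L : B b n * (b - a) @[n --> \oo] -->
      (harmonic_sum (b - 1) - euler_gamma R) * (b - a).
    by apply: cvgMl; exact: cvgB_.
  apply: ler_cvg_to (cvg_cst _) L _; near=> n.
  have /andP[l1 _] := lnS n.
  rewrite (GE n) BE; have := hD_le (an1 n) d01.
  move: l1; rewrite -mulr_suml.
  move: (\sum_(1 <= k < n.+1) _) (\sum_(1 <= k < n.+1) _) => s1 s2.
  move: (h _) (h _) (ln _) => p q r; nra.
Unshelve. all: by end_near. Qed.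

End WendelInequality.

Lemma ln_Gamma_slope_bounds :
  slope_bounds (fun z => ln (Gamma z)) (fun z => harmonic_sum (z - 1) - euler_gamma R).
Proof.
apply: wendel_slope_bounds => [z z1|z d z1 d01].
  by rewrite GammaD1// lnM// posrE ?Gamma_gt0//; lra.
have /andP[d0 d1] := d01; have z0 : 0 < z by lra.
have zd1 : 1 < z + d by lra.
rewrite -ln_powR -lnM ?posrE ?powR_gt0 ?Gamma_gt0//.
by rewrite ler_ln ?posrE ?mulr_gt0 ?powR_gt0 ?Gamma_gt0 ?GammaD_le//.
Qed.

Lemma hurwitz_sum_continuous n z : (1 < n)%N -> 1 < z ->
  {for z, continuous (fun z => hurwitz_sum n (z - 1))}.
Proof. by move=> n1; apply: slope_bounds_continuous (hurwitz_slope_bounds n1). Qed.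

Lemma is_derive_hurwitz_sum n z : (1 < n)%N -> 1 < z ->
  is_derive z 1 (fun z => hurwitz_sum n (z - 1)) (- n%:R * hurwitz_sum n.+1 (z - 1)).
Proof.
move=> n1 z1; apply: (slope_bounds_derive (hurwitz_slope_bounds n1) z1).
by apply: cvgMr; exact: (hurwitz_sum_continuous (leqW n1) z1).
Qed.

Lemma is_derive_harmonic_sum z : 1 < z ->
  is_derive z 1 (fun z => harmonic_sum (z - 1)) (hurwitz_sum 2 (z - 1)).
Proof.
move=> z1.
have H : is_derive z 1 (fun z => - harmonic_sum (z - 1)) (- hurwitz_sum 2 (z - 1)).
  apply: (slope_bounds_derive harmonic_slope_bounds z1).
  by apply: cvgN; exact: (hurwitz_sum_continuous (isT : 1 < 2)%N z1).
have -> : (fun z => harmonic_sum (z - 1)) = - (fun z => - harmonic_sum (z - 1)).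
  by apply/funext => w; rewrite opprfctE opprK.
by rewrite -[hurwitz_sum _ _]opprK; exact: is_deriveN.
Qed.

Lemma is_derive_ln_Gamma z : 1 < z ->
  is_derive z 1 (fun z => ln (Gamma z)) (harmonic_sum (z - 1) - euler_gamma R).
Proof.
move=> z1; apply: (slope_bounds_derive ln_Gamma_slope_bounds z1).
apply: cvgB; last exact: cvg_cst.
have [d _] := is_derive_harmonic_sum z1.
suff : {for z, continuous (fun z => harmonic_sum (z - 1))} by [].
exact/differentiable_continuous/derivable1_diffP.
Qed.

Lemma near_gt1 z : 1 < z -> \forall w \near z, 1 < w.
Proof. exact: lt_nbhsr. Qed.

Lemma digammaE z : 1 < z -> digamma z = harmonic_sum (z - 1) - euler_gamma R.
Proof.
move=> z1; have dG := is_derive_ln_Gamma z1.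
have dE : is_derive z 1 (expR \o (fun z => ln (Gamma z)))
    (expR (ln (Gamma z)) * (harmonic_sum (z - 1) - euler_gamma R)).
  exact: is_derive1_comp.
have : is_derive z 1 Gamma (expR (ln (Gamma z)) * (harmonic_sum (z - 1) - euler_gamma R)).
  apply: near_eq_is_derive dE => //.
  near=> w; rewrite /= lnK// posrE; apply: Gamma_gt0.
  by near: w; exact: near_gt1.
move=> D; rewrite /digamma derive1E derive_val lnK ?posrE ?Gamma_gt0//.
by rewrite mulrAC divff ?mul1r// gt_eqF// Gamma_gt0.
Unshelve. all: by end_near. Qed.

Lemma polygammaE n z : 1 < z -> derive1n n.+1 digamma z =
  (-1) ^+ n * (n.+1)`!%:R * hurwitz_sum n.+2 (z - 1).
Proof.
elim: n z => [|n IH] z z1.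
  have D := is_derive_harmonic_sum z1.
  have : is_derive z 1 (digamma : R -> R) (hurwitz_sum 2 (z - 1)).
    have D2 : is_derive z 1 (fun z => harmonic_sum (z - 1) - euler_gamma R)
        (hurwitz_sum 2 (z - 1)).
      by apply: is_derive_eq; rewrite subr0.
    apply: near_eq_is_derive D2 => //; near=> w; rewrite digammaE//.
    by near: w; exact: near_gt1.
  by move=> D3; rewrite /= derive1E derive_val expr0 factS fact0 muln1 !mul1r.
rewrite derive1nS.
have D := is_derive_hurwitz_sum (isT : 1 < n.+2)%N z1.
have D2 : is_derive z 1 (fun z => (-1) ^+ n * (n.+1)`!%:R * hurwitz_sum n.+2 (z - 1))
   ((-1) ^+ n * (n.+1)`!%:R * (- n.+2%:R * hurwitz_sum n.+3 (z - 1))).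
  by have := @is_deriveZ _ _ _ _ ((-1) ^+ n * (n.+1)`!%:R) _ _ _ D.
have D3 : is_derive z 1 (derive1n n.+1 (digamma : R -> R))
   ((-1) ^+ n * (n.+1)`!%:R * (- n.+2%:R * hurwitz_sum n.+3 (z - 1))).
  apply: near_eq_is_derive D2 => //; near=> w; rewrite IH//.
  by near: w; exact: near_gt1.
rewrite derive1E derive_val [(n.+2)`!]factS natrM exprS; ring.
Unshelve. all: by end_near. Qed.

End Digamma.

(** * Partial fractions *)

Section PartialFractions.
Context {R : comNzRingType}.
Implicit Types (w U V : R) (r t : nat).

(** With [w = 1 / (B - A)] and [U = 1 / A] this is the part with poles at
    [A = 0] of the partial fraction expansion of [A^-r B^-t]; the part with
    poles at [B = 0] is obtained by exchanging [A] and [B], hence [w] and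
    [- w]. The truncated predecessor makes ['C((t + i).-1, i)] follow the
    conventions for negative entries when [t = 0]. *)
Definition principal_part w r t U : R :=
  \sum_(0 <= i < r) (-1) ^+ i * 'C((t + i).-1, i)%:R * w ^+ (t + i) * U ^+ (r - i).

(** Pascal's rule, coefficient by coefficient. *)
Lemma principal_part_rec w r t U :
  principal_part w r.+1 t.+1 U =
  w * (principal_part w r.+1 t U - principal_part w r t.+1 U).
Proof.
rewrite /principal_part big_nat_recl//= [in RHS]big_nat_recl//=.
rewrite !bin0 !addn0 !subn0 !expr0 !mul1r.
rewrite -addrA -sumrB mulrDr mulrA -exprS mulr_sumr; congr (_ + _).
apply: eq_big_nat => i _.
rewrite !addSn !addnS/= binS natrD !subSS !exprS; ring.
Qed.

Lemma principal_part0 w r U : (0 < r)%N -> principal_part w r 0 U = U ^+ r.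
Proof.
case: r => // r _; rewrite /principal_part big_nat_recl//= big1_seq.
  by rewrite addr0 bin0 !expr0 subn0 !mul1r.
by move=> i _; rewrite !add0n/= bin_small// mulr0 !mul0r.
Qed.

Lemma principal_part_nil w t U : principal_part w 0 t U = 0.
Proof. by rewrite /principal_part big_geq. Qed.

(** Both sides satisfy the recurrence
    [F (r+1) (t+1) = w (F (r+1) t - F r (t+1))], the left one because
    [U V = w (U - V)]. *)
Lemma partial_fractions w U V r t : U * V = w * (U - V) -> (0 < r + t)%N ->
  U ^+ r * V ^+ t = principal_part w r t U + principal_part (- w) t r V.
Proof.
move=> UV; elim: r t => [|r IHr] t.
  by rewrite add0n => t0; rewrite principal_part_nil principal_part0// mul1r add0r.
elim: t => [|t IHt] _.
  by rewrite principal_part0// principal_part_nil mulr1 addr0.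
have H1 := IHt isT; have H2 := IHr t.+1 (ltn_addl r (ltn0Sn t)).
rewrite !principal_part_rec.
have -> : U ^+ r.+1 * V ^+ t.+1 = w * (U ^+ r.+1 * V ^+ t - U ^+ r * V ^+ t.+1).
  transitivity (U ^+ r * V ^+ t * (U * V)); first by rewrite !exprS; ring.
  by rewrite UV !exprS; ring.
by rewrite H1 H2; ring.
Qed.

Lemma binz_natE (i t : nat) : binz (i%:Z + t%:Z - 1) i%:Z = 'C((t + i).-1, i).
Proof.
case: (posnP (t + i)) => [/eqP|ti0].
  by rewrite addn_eq0 => /andP[/eqP-> /eqP->].
have -> : i%:Z + t%:Z - 1 = (t + i).-1%:Z.
  by rewrite -PoszD addnC -{1}(prednK ti0) -addn1 PoszD addrK.
by [].
Qed.

(** The simple poles [U] and [V] have opposite coefficients. They are taken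
    together because, summed over [k], they converge only as the difference
    [U - V], which produces the digamma term. *)
Lemma partial_fractions_regrouped w U V r t :
  U * V = w * (U - V) -> (1 < r + t)%N ->
  U ^+ r * V ^+ t =
    (-1) ^+ r * (\sum_(0 <= j < t.-1)
      (binz (j%:Z + r%:Z - 1) j%:Z)%:R * w ^+ (j + r) * V ^+ (t - j))
    + \sum_(0 <= i < r.-1)
      (-1) ^+ i * w ^+ (t + i) * (binz (i%:Z + t%:Z - 1) i%:Z)%:R * U ^+ (r - i)
    - (-1) ^+ r * w ^+ (r + t - 1) * (binz (r%:Z + t%:Z - 2) (t%:Z - 1))%:R * (U - V).
Proof.
move=> UV rt1; rewrite (partial_fractions UV (ltnW rt1)).
have -> : \sum_(0 <= i < r.-1)
    (-1) ^+ i * w ^+ (t + i) * (binz (i%:Z + t%:Z - 1) i%:Z)%:R * U ^+ (r - i) =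
    \sum_(0 <= i < r.-1) (-1) ^+ i * 'C((t + i).-1, i)%:R * w ^+ (t + i) * U ^+ (r - i).
  by apply: eq_big_nat => i _; rewrite binz_natE; ring.
have -> : (-1) ^+ r * (\sum_(0 <= j < t.-1)
      (binz (j%:Z + r%:Z - 1) j%:Z)%:R * w ^+ (j + r) * V ^+ (t - j)) =
    \sum_(0 <= j < t.-1) (-1) ^+ j * 'C((r + j).-1, j)%:R * (- w) ^+ (r + j) * V ^+ (t - j).
  rewrite mulr_sumr; apply: eq_big_nat => j _.
  rewrite binz_natE [(j + r)%N]addnC [(- w) ^+ _]exprNn [(-1) ^+ (r + j)]exprD.
  have := sqrr_sign R j; rewrite expr2.
  move: ((-1) ^+ j) => s ss.
  transitivity ((-1) ^+ r * (s * s) * 'C((r + j).-1, j)%:R * w ^+ (r + j) * V ^+ (t - j)).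
    by rewrite ss; ring.
  by ring.
rewrite /principal_part.
case: r t rt1 => [|r] [|t] //= rt1.
- rewrite !(big_geq (leqnn 0)) [in LHS]big_nat_recr//= add0n subSnn.
  rewrite bin_small; last first.
    by case: t rt1.
  have -> : binz (0%:Z + t.+1%:Z - 2) (t.+1%:Z - 1) = 0%N.
    case: t rt1 => // t _.
    have -> : 0%:Z + t.+2%:Z - 2 = t%:Z by lia.
    have -> : t.+2%:Z - 1 = t.+1%:Z by lia.
    by rewrite /= bin_small.
  ring.
- rewrite !(big_geq (leqnn 0)) [in LHS]big_nat_recr//= add0n subSnn.
  rewrite bin_small; last first.
    by case: r rt1.
  have -> : binz (r.+1%:Z + 0%:Z - 2) (0%:Z - 1) = 0%N.
    by case: r rt1.
  ring.
- rewrite big_nat_recr//= [X in _ + X]big_nat_recr//= !subSnn.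
  have -> : binz (r.+1%:Z + t.+1%:Z - 2) (t.+1%:Z - 1) = 'C(r + t, t).
    have -> : r.+1%:Z + t.+1%:Z - 2 = (r + t)%:Z by lia.
    by have -> : t.+1%:Z - 1 = t%:Z by lia.
  have -> : 'C(t + r, r) = 'C(r + t, t) by rewrite addnC -[in RHS]bin_sub ?leq_addl// addnK.
  rewrite addnS subn1/= addnC [(- w) ^+ _]exprNn.
  have -> : (t.+1 + r = r.+1 + t)%N by rewrite addSn addSn addnC.
  rewrite [(-1) ^+ (r.+1 + t)]exprD !expr1.
  have := sqrr_sign R t; rewrite expr2.
  move: ((-1) ^+ t) => s ss.
  rewrite (_ : s * _ * _ * V = (s * s) * (-1) ^+ r.+1 * 'C(t + r, t)%:R * w ^+ (r.+1 + t) * V).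
    by rewrite ss exprS; ring.
  by ring.
Qed.

End PartialFractions.

(** * The double series *)

Section DoubleSeries.
Context {R : realType}.
Implicit Types (x : R) (u : nat -> R).

Lemma sums_to_cvg u l : sums_to u l -> sums_to u (sum_from1 u).
Proof. by move=> ul; rewrite (sums_to_sum_from1 ul). Qed.

(** The powers in [zeta] are real ones, those of the partial fractions are
    natural ones. *)
Lemma zetaP n : (1 < n)%N -> sums_to (fun k => (k%:R ^+ n)^-1) (zeta n%:R : R).
Proof.
move=> n1; rewrite /zeta.
have := @sums_to_inv_pow R n n1.
have E k : (k%:R ^+ n)^-1 = k%:R `^ (- n%:R) :> R by rewrite powR_invn.
by rewrite (_ : (fun k => (k%:R ^+ n)^-1) = (fun k => k%:R `^ (- n%:R)))//; exact/funext.
Qed.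

(** The summand is of order [m^-(e + n + 1)]. *)
Lemma polygamma_sumP n e x : (0 < e + n)%N -> 0 < x ->
  sums_to (fun m => derive1n n.+1 digamma (m%:R * x + 1) / m%:R ^+ e)
    (sum_from1 (fun m => derive1n n.+1 digamma (m%:R * x + 1) / m%:R ^+ e)).
Proof.
move=> en x0.
have pow_cvg := sums_toZ ((x ^+ n.+1)^-1) (@sums_to_inv_pow R (e + n).+1 en).
have H : sums_to (fun m => hurwitz_sum n.+2 (m%:R * x) / m%:R ^+ e)
    (sum_from1 (fun m => hurwitz_sum n.+2 (m%:R * x) / m%:R ^+ e)).
  apply: dominated_sums_to pow_cvg _ => m m0.
  have m1 : 1 <= m%:R :> R by exact: natr_ge1.
  have mx0 : 0 < m%:R * x by nra.
  have e0 : 0 <= (m%:R ^+ e)^-1 :> R by rewrite invr_ge0 exprn_ge0.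
  apply/andP; split.
    rewrite mulr_ge0//; apply: sums_to_ler sums_to0 (hurwitz_sumP _ mx0) _ => // k k0.
    by rewrite invr_ge0 exprn_ge0// addr_ge0// ltW.
  apply: le_trans (ler_wpM2r e0 (hurwitz_sum_le n mx0)) _.
  by rewrite exprMn -addnS exprD !invfM; lra.
apply: (@sums_to_cvg _ ((-1) ^+ n * (n.+1)`!%:R * _)).
apply: eq_sums_to (sums_toZ ((-1) ^+ n * (n.+1)`!%:R) H) => m m0.
have m1 : 1 <= m%:R :> R by exact: natr_ge1.
by rewrite polygammaE ?addrK ?mulrA//; nra.
Qed.

(** The summand is at most of order [m^(-3/2)], by the square root bound on
    [harmonic_sum]. *)
Lemma digamma_sumP e x : (1 < e)%N -> 0 < x ->
  sums_to (fun m => (euler_gamma R + digamma (m%:R * x + 1)) / m%:R ^+ e)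
    (sum_from1 (fun m => (euler_gamma R + digamma (m%:R * x + 1)) / m%:R ^+ e)).
Proof.
move=> e1 x0; set K := sum_from1 (fun k => (k%:R * Num.sqrt k%:R)^-1 : R).
apply: dominated_sums_to (sums_toZ (K * Num.sqrt x) (@sums_to_inv_mul_sqrt R)) _ => m m0.
have m1 : 1 <= m%:R :> R by exact: natr_ge1.
have mx0 : 0 < m%:R * x by nra.
rewrite digammaE; last lra.
rewrite addrK addrCA subrr addr0.
have e0 : 0 <= (m%:R ^+ e)^-1 :> R by rewrite invr_ge0 exprn_ge0.
have h0 : 0 <= harmonic_sum (m%:R * x).
  by apply: sums_to_ler sums_to0 (harmonic_sumP mx0) _ => // k k0; exact: inv_sub_inv_ge0.
rewrite mulr_ge0//=.
have e2 : (m%:R ^+ e)^-1 <= (m%:R ^+ 2)^-1 :> R.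
  by rewrite lef_pV2 ?posrE ?exprn_gt0 ?ler_weXn2l//; lra.
apply: le_trans (ler_wpM2l h0 e2) _.
have m2 : 0 <= (m%:R ^+ 2)^-1 :> R by rewrite invr_ge0 exprn_ge0.
apply: le_trans (ler_wpM2r m2 (harmonic_sum_le mx0)) _; rewrite -/K.
rewrite sqrtrM//.
have s0 : 0 < Num.sqrt (m%:R : R) by rewrite sqrtr_gt0; lra.
have sE : Num.sqrt m%:R ^+ 2 = m%:R :> R by rewrite sqr_sqrtr.
move: (Num.sqrt m%:R) s0 sE => c s0 <-.
by rewrite le_eqVlt; apply/orP; left; apply/eqP; field; lra.
Qed.

(** For fixed [m], the summand of [calF] is the sum over [k] of the partial
    fraction expansion with [A = k] and [B = k + m x], multiplied by [m^-r]:
    Hurwitz sums give the polygamma terms, powers of [k] the zeta values, and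
    the paired simple poles the digamma term. *)
Lemma double_series r t x : (1 < r + t)%N -> (2 < 2 * r + t)%N -> 0 < x ->
  exists2 s : nat -> R, sums_to s (calF r t x) & forall m, (0 < m)%N ->
    sums_to (fun k => (m%:R ^+ r * k%:R ^+ r * (k%:R + m%:R * x) ^+ t)^-1) (s m).
Proof.
move=> rt1 rt2 x0.
exists (fun m => (-1) ^+ r *
    (\sum_(0 <= j < t.-1)
       ((binz (j%:Z + r%:Z - 1) j%:Z)%:R
       * ((-1) ^+ (t - j) / ((t - j - 1)`!)%:R)
       * (1 / x ^+ (j + r)))
       * (derive1n (t - j - 1) digamma (m%:R * x + 1) / m%:R ^+ (2 * r + j)))
  + \sum_(0 <= i < r.-1)
      ((-1) ^+ i / x ^+ (t + i)
      * (binz (i%:Z + t%:Z - 1) i%:Z)%:R * zeta (r - i)%:R) * (m%:R ^+ (r + t + i))^-1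
  - (-1) ^+ r / x ^+ (r + t - 1)
    * (binz (r%:Z + t%:Z - 2) (t%:Z - 1))%:R
    * ((euler_gamma R + digamma (m%:R * x + 1)) / m%:R ^+ (2 * r + t - 1))).
  apply: sums_toB.
    apply: sums_toD.
      apply: sums_toZ; apply: sums_to_sum => j jt; apply: sums_toZ.
      have -> : (t - j - 1 = (t - j - 2).+1)%N by lia.
      by apply: polygamma_sumP => //; lia.
    set z := (X in sums_to _ X).
    have -> : z = \sum_(0 <= i < r.-1) ((-1) ^+ i / x ^+ (t + i)
      * (binz (i%:Z + t%:Z - 1) i%:Z)%:R * zeta (r - i)%:R) * zeta (r + t + i)%:R.
      by apply: eq_big_nat => i _; ring.
    by apply: sums_to_sum => i ir; apply: sums_toZ; apply: zetaP; lia.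
  by apply: sums_toZ; apply: digamma_sumP => //; lia.
move=> m m0; have m1 : 1 <= m%:R :> R by exact: natr_ge1.
have mx0 : 0 < m%:R * x by nra.
have mx1 : 1 < m%:R * x + 1 by lra.
pose w := (m%:R * x)^-1.
rewrite digammaE// addrCA subrr addr0 addrK.
have inner1 := sums_to_sum (fun j (jt : (j < t.-1)%N) =>
  sums_toZ ((binz (j%:Z + r%:Z - 1) j%:Z)%:R * w ^+ (j + r))
   (@hurwitz_sumP R (t - j) (m%:R * x) (ltac:(lia)) mx0)).
have inner2 := sums_to_sum (fun i (ir : (i < r.-1)%N) =>
  sums_toZ ((-1) ^+ i * w ^+ (t + i) * (binz (i%:Z + t%:Z - 1) i%:Z)%:R)
   (@zetaP (r - i) (ltac:(lia)))).
have inner3 := sums_toZ ((-1) ^+ r * w ^+ (r + t - 1) *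
  (binz (r%:Z + t%:Z - 2) (t%:Z - 1))%:R) (harmonic_sumP mx0).
have inner := sums_toZ ((m%:R ^+ r)^-1)
  (sums_toB (sums_toD (sums_toZ ((-1) ^+ r) inner1) inner2) inner3).
have pw e : (m%:R ^+ r)^-1 * w ^+ e = (x ^+ e)^-1 * (m%:R ^+ (r + e))^-1.
  by rewrite /w exprVn exprMn exprD !invfM; ring.
set S := (X in sums_to _ X) in inner.
set T := (X in sums_to _ X).
have -> : T = S.
  rewrite /T /S mulrBr mulrDr; congr (_ + _ - _).
  - rewrite mulrCA; congr (_ * _); rewrite mulr_sumr; apply: eq_big_nat => j /andP[_ jt].
    have -> : (t - j - 1 = (t - j - 2).+1)%N by lia.
    have tj : (t - j = (t - j - 2).+2)%N by lia.
    rewrite polygammaE// addrK -tj.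
    have sgn : (-1) ^+ (t - j) * (-1) ^+ (t - j - 2) = 1 :> R.
      by rewrite {1}tj !exprS !mulN1r opprK -expr2 sqrr_sign.
    have fact_neq0 : ((t - j - 2).+1)`!%:R != 0 :> R by rewrite pnatr_eq0 -lt0n fact_gt0.
    have := pw (j + r)%N; rewrite (_ : r + (j + r) = 2 * r + j)%N; last lia.
    move=> pwj; rewrite [RHS](_ : _ = (binz (j%:Z + r%:Z - 1) j%:Z)%:R *
      (m%:R ^- r * w ^+ (j + r)) * hurwitz_sum (t - j) (m%:R * x)); last by ring.
    rewrite pwj -[RHS]mul1r -[X in _ = X * _]sgn; move: fact_neq0.
    move: (((t - j - 2).+1)`!%:R : R) => f f0; field;
      rewrite ?expf_neq0//; lra.
  - rewrite mulr_sumr; apply: eq_big_nat => i _.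
    rewrite [RHS](_ : _ = (-1) ^+ i * (m%:R ^- r * w ^+ (t + i)) *
      (binz (i%:Z + t%:Z - 1) i%:Z)%:R * zeta (r - i)%:R); last by ring.
    by rewrite pw addnA; ring.
  - have := pw (r + t - 1)%N; rewrite (_ : r + (r + t - 1) = 2 * r + t - 1)%N; last lia.
    move=> pwr; rewrite [RHS](_ : _ = (-1) ^+ r * (m%:R ^- r * w ^+ (r + t - 1)) *
      (binz (r%:Z + t%:Z - 2) (t%:Z - 1))%:R * harmonic_sum (m%:R * x)); last by ring.
    by rewrite pwr; ring.
move: inner; apply: eq_sums_to => k k0.
have k1 : 1 <= k%:R :> R by exact: natr_ge1.
have UV : k%:R^-1 * (k%:R + m%:R * x)^-1 = w * (k%:R^-1 - (k%:R + m%:R * x)^-1).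
  by rewrite /w; field; lra.
rewrite -[in RHS]mulrA invfM; congr (_ * _); rewrite invfM.
rewrite -!exprVn (partial_fractions_regrouped UV rt1).
by congr (_ * _ + _ - _); apply: eq_big_nat => j _; rewrite -exprVn.
Qed.

End DoubleSeries.

Theorem theorem4p3 (R : realType) (r t : nat)
    (hrt : (1 < r + t)%N) (h2rt : (2 < 2 * r + t)%N) :
  forall x : R, 0 < x -> calF r t x = (x ^+ t)^-1 * calF r t x^-1.
Proof.
move=> x x0; have xV0 : 0 < x^-1 by rewrite invr_gt0.
have [s sF rows] := double_series hrt h2rt x0.
have [s' s'F rows'] := double_series hrt h2rt xV0.
apply: exchange_sums _ rows sF _ (sums_toZ (x ^+ t)^-1 s'F).
  by move=> m k m0 k0; rewrite invr_ge0 !mulr_ge0// exprn_ge0// addr_ge0// mulr_ge0// ltW.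
move=> k k0; apply: eq_sums_to (sums_toZ (x ^+ t)^-1 (rows' k k0)) => m m0 /=.
rewrite -invfM; congr (_^-1).
have -> : k%:R + m%:R * x = x * (m%:R + k%:R * x^-1) by field; lra.
by rewrite exprMn; ring.
Qed.
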